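(* Let $\Sigma$ be a finite alphabet, $h:\Sigma^*\to M$ a monoid morphism into a finite monoid, and $L\subseteq\Sigma^*$. Assume that $L$ is $h$-substitutable, that $(L,h)$ is unit-separated, and that $(L,h)$ satisfies PTLD. Then every live non-unit relative class has a unique exact factorization into relative primes.
   Context: $D_L(x)=\{(u,v):uxv\in L\}$; $x\equiv_L y$ iff $D_L(x)=D_L(y)$. $L$ is $h$-substitutable if for all $x,y\in\Sigma^*$, $h(x)=h(y)$ and $D_L(x)\cap D_L(y)\ne\varnothing$ imply $x\equiv_L y$. The relative syntactic congruence $\theta$ is: $x\,\theta\,y$ iff $x\equiv_L y$ and $h(x)=h(y)$; its classes $[x]$ are called relative classes; all members of a class $P$ have the same $h$-value, denoted $h(P)$. A relative class is live if $D_L(x)\neq\varnothing$ for its members. The unit class is $[\varepsilon]$; non-unit means different from it. $(L,h)$ is unit-separated if $[\varepsilon]=\{\varepsilon\}$. $X\cdot Y=\{xy:x\in X,y\in Y\}$. A relative prime is a live non-unit relative class $P$ such that whenever $P=X\cdot Y$ (equality of sets) for relative classes $X,Y$, one of $X,Y$ is $[\varepsilon]$. An exact factorization of a class $X$ into relative primes is a finite nonempty sequence $(P_1,\dots,P_k)$ of relative primes with $X=P_1\cdot\ldots\cdot P_k$ as sets of words; uniqueness refers to the sequence. PTLD (prime-target left-division determinism): let $\mathsf T=h(\{x\in\Sigma^*:D_L(x)\ne\varnothing\})\subseteq M$; then for every $q,r,r'\in\mathsf T$ and every relative prime $P$, $qr=h(P)=qr'$ implies $r=r'$. *)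

(* Defs.v *)
From mathcomp Require Import all_boot.
From mathcomp Require Import mathcomp_extra boolp classical_sets cardinality.

Set Implicit Arguments.
Unset Strict Implicit.
Unset Printing Implicit Defensive.

Local Open Scope classical_set_scope.
Local Open Scope group_scope.

Definition word_morphism (A : Type) (M : monoidType) (h : seq A -> M) : Prop :=
  h [::] = 1 /\ {morph h : u v / u ++ v >-> u * v}.

Definition cat_set (A : Type) (X Y : set (seq A)) : set (seq A) :=
  [set x ++ y | x in X & y in Y].

Definition contexts (A : Type) (L : set (seq A)) (x : seq A) :
    set (seq A * seq A) :=
  [set uv | L (uv.1 ++ x ++ uv.2)].

Definition syn_equiv (A : Type) (L : set (seq A)) (x y : seq A) : Prop :=
  contexts L x = contexts L y.

Section RelativeClasses.
Variables (A : Type) (M : monoidType) (h : seq A -> M) (L : set (seq A)).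
Implicit Types (x y : seq A) (X Y P : set (seq A)).

Definition substitutable : Prop :=
  forall x y, h x = h y -> contexts L x `&` contexts L y !=set0 ->
  syn_equiv L x y.

Definition rel_cong x y : Prop := syn_equiv L x y /\ h x = h y.

Definition rel_class x : set (seq A) := [set y | rel_cong x y].

Definition is_rel_class X : Prop := exists x, X = rel_class x.

Definition live X : Prop := forall x, X x -> contexts L x !=set0.

Definition unit_class : set (seq A) := rel_class [::].

Definition unit_separated : Prop := unit_class = [set [::]].

Definition rel_prime P : Prop :=
  [/\ is_rel_class P, live P, P <> unit_class &
      forall X Y, is_rel_class X -> is_rel_class Y -> P = cat_set X Y ->
      X = unit_class \/ Y = unit_class].

Definition exact_factorization X (Ps : seq (set (seq A))) : Prop :=
  [/\ Ps <> [::], (forall P, P \in Ps -> rel_prime P) &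
      X = \big[@cat_set A/[set [::]]]_(P <- Ps) P].

(* [h] is constant on a relative class [P]; [class_value P m] says h(P) = m. *)
Definition class_value P (m : M) : Prop := h @` P = [set m].

Definition live_values : set M := h @` [set x | contexts L x !=set0].

Definition PTLD : Prop :=
  forall (q r r' : M) P,
    live_values q -> live_values r -> live_values r' -> rel_prime P ->
    class_value P (q * r) -> class_value P (q * r') -> r = r'.

End RelativeClasses.

(* Main.v *)
(** Existence is by induction on the length of a word of the class, since unit
    separation makes both factors of a nontrivial product lose letters.

    For uniqueness, PTLD and substitutability give a left division rule: if
    [p r] and [p' r'] lie in the same prime and [p], [p'] are congruent, then
    so are [r] and [r'].  Hence a prime is a prefix code.  If [P Z = Q Z'] with
    [P], [Q] prime and a word of [Q] is [p r] with [p] in [P], then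
    [Q = P [r]], so [r] is empty and [P = Q]; the prefix code property then
    gives [Z = Z'].  The tails need not be relative classes. *)
From HB Require Import structures.
Require Import Defs.
From mathcomp Require Import all_boot.
From mathcomp Require Import mathcomp_extra boolp classical_sets cardinality.

Set Implicit Arguments.
Unset Strict Implicit.

Local Open Scope classical_set_scope.

(** * Languages under concatenation *)

Section CatSet.
Variable A : Type.

Lemma cat_setA : associative (@cat_set A).
Proof.
move=> X Y Z; apply/seteqP; split=> w.
  move=> [x Xx [_ [y Yy [z Zz <-]] <-]]; rewrite catA.
  by exists (x ++ y); [exists x => //; exists y | exists z].
move=> [_ [x Xx [y Yy <-]] [z Zz <-]]; rewrite -catA.
by exists x => //; exists (y ++ z) => //; exists y => //; exists z.
Qed.

Lemma cat_set1s : left_id [set [::]] (@cat_set A).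
Proof.
move=> X; apply/seteqP; split=> w; first by move=> [_ -> [y Yy <-]].
by move=> Xw; exists [::] => //; exists w.
Qed.

Lemma cat_sets1 : right_id [set [::]] (@cat_set A).
Proof.
move=> X; apply/seteqP; split=> w.
  by move=> [x Xx [_ -> <-]]; rewrite cats0.
by move=> Xw; exists w => //; exists [::] => //; rewrite cats0.
Qed.

(** The monoid structure lets [big_cat] join two factorizations. *)
HB.instance Definition _ := Monoid.isLaw.Build (set (seq A)) [set [::]]
  (@cat_set A) cat_setA cat_set1s cat_sets1.

(** Levi's lemma, of which only the comparability of the two prefixes is kept. *)
Lemma cat_eq_prefix (a b c d : seq A) : a ++ b = c ++ d ->
  (exists s, c = a ++ s) \/ (exists s, a = c ++ s).
Proof.
elim: a c => [|x a IH] [|y c] /=; first by left; exists [::].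
- by left; exists (y :: c).
- by right; exists (x :: a).
by move=> [-> /IH[[s ->]|[s ->]]]; [left|right]; exists s.
Qed.

End CatSet.

Section Factorization.
Variables (A : Type) (M : monoidType) (h : seq A -> M) (L : set (seq A)).
Hypothesis h_morph : word_morphism h.

Let hM u v : h (u ++ v) = (h u * h v)%g.
Proof. by case: h_morph => _ ->. Qed.

(** * The relative congruence and its classes *)

Lemma rel_cong_refl x : rel_cong h L x x.
Proof. by []. Qed.

Lemma rel_cong_sym x y : rel_cong h L x y -> rel_cong h L y x.
Proof. by case. Qed.

Lemma rel_cong_trans x y z :
  rel_cong h L x y -> rel_cong h L y z -> rel_cong h L x z.
Proof. by move=> [e1 e2] [e3 e4]; split; [exact: etrans e3 | rewrite e2]. Qed.

Lemma syn_equivP x y u v : syn_equiv L x y ->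
  L (u ++ x ++ v) -> L (u ++ y ++ v).
Proof.
by move=> e Lx; have : contexts L x (u, v) by []; rewrite e.
Qed.

(** The factors are replaced one at a time, the other factor being absorbed into the context. *)
Lemma rel_cong_cat x x' y y' : rel_cong h L x x' -> rel_cong h L y y' ->
  rel_cong h L (x ++ y) (x' ++ y').
Proof.
have sub a a' b b' : syn_equiv L a a' -> syn_equiv L b b' ->
    contexts L (a ++ b) `<=` contexts L (a' ++ b').
  move=> ea eb [u v]; rewrite /contexts /= -!catA => /(syn_equivP ea).
  by rewrite catA => /(syn_equivP eb); rewrite -catA.
move=> [ex hx] [ey hy]; split; last by rewrite !hM hx hy.
by apply/seteqP; split; apply: sub.
Qed.

Lemma rel_class_eq x y : rel_cong h L x y -> rel_class h L x = rel_class h L y.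
Proof.
move=> e; apply/seteqP; split=> z; last exact: rel_cong_trans.
by apply: rel_cong_trans; apply: rel_cong_sym.
Qed.

Lemma is_rel_class_mem X x : is_rel_class h L X -> X x -> X = rel_class h L x.
Proof. by move=> [y ->] /rel_class_eq. Qed.

Lemma is_rel_class_cong X x y :
  is_rel_class h L X -> X x -> X y -> rel_cong h L x y.
Proof. by move=> cX /(is_rel_class_mem cX) ->. Qed.

Lemma live_factors x y : contexts L (x ++ y) !=set0 ->
  contexts L x !=set0 /\ contexts L y !=set0.
Proof.
move=> [[u v] Luv]; split; [exists (u, y ++ v) | exists (u ++ x, v)];
  by move: Luv; rewrite /contexts /= -!catA.
Qed.

Lemma live_rel_class x : contexts L x !=set0 -> live L (rel_class h L x).
Proof. by move=> lx y [<-]. Qed.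

Lemma rel_class_value P x :
  is_rel_class h L P -> P x -> class_value h P (h x).
Proof.
move=> cP Px; apply/seteqP; split=> m; last by move=> ->; exists x.
by move=> [y Py <-]; have [_ ->] := is_rel_class_cong cP Px Py.
Qed.

(** * Unit separation and existence *)

Hypothesis L_unit : unit_separated h L.

Lemma rel_cong_nil x : rel_cong h L [::] x -> x = [::].
Proof.
by move=> e; have : unit_class h L x := e; rewrite L_unit.
Qed.

Lemma nonunit_nil X : is_rel_class h L X -> X <> unit_class h L -> ~ X [::].
Proof. by move=> cX nX /(is_rel_class_mem cX). Qed.

Lemma factorization_exists x : contexts L x !=set0 -> x <> [::] ->
  exists Ps, exact_factorization h L (rel_class h L x) Ps.
Proof.
have [n] := ubnP (size x); elim: n x => // n IH x ltxn lx nx.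
have cX : is_rel_class h L (rel_class h L x) by exists x.
have Xu : rel_class h L x <> unit_class h L.
  move=> e; apply: nx; apply: rel_cong_nil.
  by change (unit_class h L x); rewrite -e; apply: rel_cong_refl.
have [pX|npX] := pselect (rel_prime h L (rel_class h L x)).
  exists [:: rel_class h L x]; split=> //; last by rewrite big_seq1.
  by move=> P; rewrite inE => /eqP ->.
have [Y [Z [cY cZ eX nY nZ]]] : exists Y Z, [/\ is_rel_class h L Y,
    is_rel_class h L Z, rel_class h L x = cat_set Y Z,
    Y <> unit_class h L & Z <> unit_class h L].
  (* The class is live and non-unit, so only irreducibility can fail. *)
  apply: contrapT => nYZ; apply: npX; split=> //; first exact: live_rel_class.
  move=> Y Z cY cZ eX; apply: contrapT => /not_orP[nY nZ].
  by apply: nYZ; exists Y, Z.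
have [y Yy [z Zz exyz]] : cat_set Y Z x by rewrite -eX; apply: rel_cong_refl.
have ny : y <> [::] by move=> y0; apply: (nonunit_nil cY nY); rewrite -y0.
have nz : z <> [::] by move=> z0; apply: (nonunit_nil cZ nZ); rewrite -z0.
have [ly lz] : contexts L y !=set0 /\ contexts L z !=set0.
  by apply: live_factors; rewrite exyz.
have szx : size y + size z = size x by rewrite -exyz size_cat.
have y_gt0 : 0 < size y by case: (y) ny.
have z_gt0 : 0 < size z by case: (z) nz.
have ltyx : size y < size x by rewrite -szx -addn1 leq_add2l.
have ltzx : size z < size x by rewrite -szx -add1n leq_add2r.
have [Ps [Ps0 Psp eY]] := IH y (leq_trans ltyx ltxn) ly ny.
have [Qs [_ Qsp eZ]] := IH z (leq_trans ltzx ltxn) lz nz.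
exists (Ps ++ Qs); split.
- by case: (Ps) Ps0.
- by move=> P; rewrite mem_cat => /orP[/Psp|/Qsp].
by rewrite eX (is_rel_class_mem cY Yy) (is_rel_class_mem cZ Zz) eY eZ
  big_cat.
Qed.

(** * Left division in a prime *)

Hypothesis L_subst : substitutable h L.
Hypothesis L_ptld : PTLD h L.

Lemma prime_left_division Q p p' r r' : rel_prime h L Q ->
  Q (p ++ r) -> Q (p' ++ r') -> rel_cong h L p p' -> rel_cong h L r r'.
Proof.
move=> pQ Qpr Qpr' [epp' hpp']; have [cQ lQ _ _] := pQ.
have [lp lr] := live_factors (lQ _ Qpr).
have [_ lr'] := live_factors (lQ _ Qpr').
have hrr' : h r = h r'.
  (* Factors of live words are live, so all three values are in [live_values]; [h p = h p'] provides
     the common left divisor. *)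
  apply: (L_ptld (q := h p) (P := Q)) => //;
    [by exists p | by exists r | by exists r' | |].
    by rewrite -hM; apply: rel_class_value.
  by rewrite hpp' -hM; apply: rel_class_value.
split=> //; apply: L_subst => //.
have [[u v] Luv] := lQ _ Qpr.
have [e _] := is_rel_class_cong cQ Qpr Qpr'.
(* This context is shared by [r] and [r']: inside [u], [v], replace [p ++ r] by [p' ++ r'], then
   [p'] by [p]. *)
exists (u ++ p, v); split; rewrite /contexts /= -catA.
  by move: Luv; rewrite /contexts /= -catA.
move: Luv => /(syn_equivP e); rewrite -catA.
by apply: syn_equivP; symmetry.
Qed.

(** Left division of [p ++ [::]] against [p ++ s] makes [s] congruent to the empty word. *)
Lemma prime_prefix_code P p s :
  rel_prime h L P -> P p -> P (p ++ s) -> s = [::].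
Proof.
move=> pP Pp Pps; apply: rel_cong_nil.
by apply: (prime_left_division pP _ Pps) => //; rewrite cats0.
Qed.

(** One fixed word [z0] after [Q] suffices to compare each word of [Q] with a word of [P]. This
    one-sided form serves with [P] and [Q] in either role. *)
Lemma prime_eq_of_prefix P Q Z z0 p r : rel_prime h L P -> rel_prime h L Q ->
  (forall q, Q q -> cat_set P Z (q ++ z0)) -> P p -> Q (p ++ r) -> P = Q.
Proof.
move=> pP pQ QZ Pp Qpr; have [cP _ nP _] := pP; have [cQ _ _ irrQ] := pQ.
have eQ : Q = cat_set P (rel_class h L r).
  apply/seteqP; split=> q; last first.
    move=> [p' Pp' [r' rr' <-]]; rewrite (is_rel_class_mem cQ Qpr).
    by apply: rel_cong_cat => //; apply: is_rel_class_cong cP Pp Pp'.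
  move=> Qq; have [p' Pp' [z _ ezz0]] := QZ q Qq.
  have pp' := is_rel_class_cong cP Pp Pp'.
  have [[s eq]|[s ep']] := cat_eq_prefix ezz0.
    exists p' => //; exists s => //; rewrite eq in Qq.
    exact: prime_left_division pQ Qpr Qq pp'.
  (* Here [p' = q ++ s] with [q] congruent to [p ++ r]. The prefix code property then empties both
     [r] and [s], so [q = p']. *)
  have Pprs : P (p ++ r ++ s).
    rewrite (is_rel_class_mem cP Pp') ep' catA; apply: rel_cong_cat => //.
    exact: is_rel_class_cong cQ Qq Qpr.
  have := prime_prefix_code pP Pp Pprs.
  case: (r) (s) ep' => [|//] [|//]; rewrite cats0 => <- _.
  by exists p' => //; exists [::]; rewrite ?cats0.
have cr : is_rel_class h L (rel_class h L r) by exists r.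
have [//|r_unit] := irrQ _ _ cP cr eQ.
have r0 : r = [::].
  apply: rel_cong_nil; change (unit_class h L r); rewrite -r_unit.
  exact: rel_cong_refl.
rewrite r0 cats0 in Qpr.
by rewrite (is_rel_class_mem cP Pp) (is_rel_class_mem cQ Qpr).
Qed.

(** * Uniqueness, factor by factor *)

Lemma prime_head_unique P Q Z Z' : rel_prime h L P -> rel_prime h L Q ->
  Z !=set0 -> cat_set P Z = cat_set Q Z' -> P = Q.
Proof.
move=> pP pQ [z Zz] e; have [[p eP] _ _ _] := pP.
have Pp : P p by rewrite eP; apply: rel_cong_refl.
have [q Qq [z' Zz' epq]] : cat_set Q Z' (p ++ z).
  by rewrite -e; exists p => //; exists z.
have [[s eps]|[s eqs]] := cat_eq_prefix epq.
  (* Here [q] is a prefix of [p], so [Q] takes the role of the shorter head. *)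
  symmetry.
  apply: (prime_eq_of_prefix pQ pP _ Qq (r := s) (Z := Z') (z0 := z));
    last by rewrite -eps.
  by move=> p' Pp'; rewrite -e; exists p' => //; exists z.
apply: (prime_eq_of_prefix pP pQ _ Pp (r := s) (Z := Z) (z0 := z'));
  last by rewrite -eqs.
by move=> q' Qq'; rewrite e; exists q' => //; exists z'.
Qed.

Lemma prime_left_cancel P Z Z' :
  rel_prime h L P -> cat_set P Z = cat_set P Z' -> Z = Z'.
Proof.
move=> pP; have [[p eP] _ _ _] := pP.
have Pp : P p by rewrite eP; apply: rel_cong_refl.
have sub Y Y' : cat_set P Y = cat_set P Y' -> Y `<=` Y'.
  move=> e y Yy; have [p' Pp' [y' Yy' eyy']] : cat_set P Y' (p ++ y).
    by rewrite -e; exists p => //; exists y.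
  (* Both prefixes lie in the prefix code [P], so they coincide and so do the remainders. *)
  have [[s es]|[s es]] := cat_eq_prefix eyy'.
    have s0 : s = [::].
      by apply: (prime_prefix_code pP Pp'); rewrite -es.
    move: eyy'; rewrite es s0 cats0 => /(congr1 (drop (size p'))).
    by rewrite !drop_size_cat // => <-.
  have s0 : s = [::] by apply: (prime_prefix_code pP Pp); rewrite -es.
  move: eyy'; rewrite es s0 cats0 => /(congr1 (drop (size p))).
  by rewrite !drop_size_cat // => <-.
by move=> e; apply/seteqP; split; apply: sub.
Qed.

(** Words of a prime are nonempty. This excludes that one of two sequences with equal products ends
    before the other. *)
Lemma prime_cat_neq1 P Z : rel_prime h L P -> cat_set P Z <> [set [::]].
Proof.
move=> [cP _ nP _] e; have [p Pp [z _]] : cat_set P Z [::] by rewrite e.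
by case: p Pp => [/(nonunit_nil cP nP)|].
Qed.

(** Supplies the nonempty tail needed to compare heads. *)
Lemma prime_prod_neq0 Ps : (forall P, P \in Ps -> rel_prime h L P) ->
  \big[@cat_set A/[set [::]]]_(P <- Ps) P !=set0.
Proof.
elim: Ps => [|P Ps IH] pPs; first by rewrite big_nil; exists [::].
have [|z Zz] := IH; first by move=> Q PsQ; apply: pPs; rewrite inE PsQ orbT.
have [[p eP] _ _ _] := pPs P (mem_head _ _).
rewrite big_cons; exists (p ++ z), p; last by exists z.
by rewrite eP; apply: rel_cong_refl.
Qed.

Lemma prime_prod_inj Ps Qs : (forall P, P \in Ps -> rel_prime h L P) ->
  (forall Q, Q \in Qs -> rel_prime h L Q) ->
  \big[@cat_set A/[set [::]]]_(P <- Ps) P =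
    \big[@cat_set A/[set [::]]]_(Q <- Qs) Q -> Ps = Qs.
Proof.
elim: Ps Qs => [|P Ps IH] [|Q Qs] pPs pQs //; rewrite ?big_nil ?big_cons.
- by move/esym/prime_cat_neq1; case; apply: pQs; apply: mem_head.
- by move/prime_cat_neq1; case; apply: pPs; apply: mem_head.
have pP := pPs P (mem_head _ _); have pQ := pQs Q (mem_head _ _).
have {}pPs R : R \in Ps -> rel_prime h L R.
  by move=> PsR; apply: pPs; rewrite inE PsR orbT.
have {}pQs R : R \in Qs -> rel_prime h L R.
  by move=> QsR; apply: pQs; rewrite inE QsR orbT.
move=> e; have ePQ := prime_head_unique pP pQ (prime_prod_neq0 pPs) e.
rewrite -ePQ in e *; congr (_ :: _); apply: IH => //.
exact: prime_left_cancel pP e.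
Qed.

End Factorization.

Unset Implicit Arguments.
Set Strict Implicit.

Theorem theorem7p21 (A : finType) (M : monoidType) (h : seq A -> M)
    (L : set (seq A)) (M_finite : finite_set [set: M])
    (h_morph : word_morphism h) (L_subst : substitutable h L)
    (L_unit : unit_separated h L) (L_ptld : PTLD h L)
    (X : set (seq A)) (X_class : is_rel_class h L X) (X_live : live L X)
    (X_nonunit : X <> unit_class h L) :
  exists! Ps : seq (set (seq A)), exact_factorization h L X Ps.
Proof.
have [x eX] := X_class.
have Xx : X x by rewrite eX; apply: rel_cong_refl.
have [||Ps fPs] := factorization_exists L_unit (x := x).
- exact: X_live.
- by move=> x0; apply: X_nonunit; rewrite eX x0.
rewrite -eX in fPs; exists Ps; split=> // Qs [_ pQs eQs].
have [_ pPs ePs] := fPs.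
by apply: (prime_prod_inj h_morph L_unit L_subst L_ptld) => //;
  rewrite -ePs.
Qed.
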